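(* Let $n\ge 1$, and let $(A,|\cdot|_A)$ be either (a) a field that is complete with respect to a nontrivial non-Archimedean absolute value $|\cdot|_{\mathrm{field}}$, equipped with the hybrid norm $|\cdot|_A=\max\{|\cdot|_{\mathrm{field}},|\cdot|_0\}$, or (b) a discrete valuation ring equipped with the trivial norm $|\cdot|_A=|\cdot|_0$. Then the analytification $\mathbf{A}^{n,\mathrm{An}}_A$ of affine $n$-space over $(A,|\cdot|_A)$ is contractible.
   Context: $|\cdot|_0$ denotes the trivial norm ($|0|_0=0$, $|a|_0=1$ for $a\neq0$). A multiplicative seminorm on a ring $B$ is a map $|\cdot|\colon B\to\mathbf{R}_{\ge 0}$ with $|0|=0$, $|1|=1$, $|fg|=|f||g|$, $|f+g|\le |f|+|g|$. The analytification $\mathbf{A}^{n,\mathrm{An}}_A$ is the set of multiplicative seminorms $x$ on $A[T_1,\dots,T_n]$ (write $|f(x)|$ for the value of $x$ at $f$) such that $|a(x)|\le|a|_A$ for all $a\in A$, with the coarsest topology making $x\mapsto|f(x)|$ continuous for every $f\in A[T_1,\dots,T_n]$. *)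

(* Defs.v *)
From HB Require Import structures.
From mathcomp Require Import all_boot all_order all_algebra.
From mathcomp Require Import all_classical all_reals topology normedtype.
(* The notations of mpoly clash with those of the analysis library, so only the
   rest is imported: mpoly n A stands for {mpoly A[n]} and mpolyC n a for
   a%:MP_[n]. *)
From mathcomp Require Import -(notations) mpoly.

Set Implicit Arguments.
Unset Strict Implicit.
Unset Printing Implicit Defensive.

Import Order.TTheory GRing.Theory Num.Theory.
Import numFieldNormedType.Exports.

Local Open Scope classical_set_scope.
Local Open Scope ring_scope.

Record multiplicative_seminorm (R : realType) (B : comNzRingType)
    (x : B -> R) : Prop := MultiplicativeSeminorm {
  mseminorm_ge0 : forall f, 0 <= x f;
  mseminorm0 : x 0 = 0;
  mseminorm1 : x 1 = 1;
  mseminormM : forall f g, x (f * g) = x f * x g;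
  mseminormD : forall f g, x (f + g) <= x f + x g }.

Definition absolute_value (R : realType) (k : fieldType) (v : k -> R) : Prop :=
  multiplicative_seminorm v /\ (forall a, v a = 0 -> a = 0).

Definition non_archimedean (R : realType) (k : fieldType) (v : k -> R) : Prop :=
  forall a b, v (a + b) <= Num.max (v a) (v b).

Definition nontrivial (R : realType) (k : fieldType) (v : k -> R) : Prop :=
  exists2 a, a != 0 & v a != 1.

Definition complete_for (R : realType) (k : fieldType) (v : k -> R) : Prop :=
  forall u : nat -> k,
    (forall e : R, 0 < e -> exists N : nat,
       forall i j : nat, (N <= i)%N -> (N <= j)%N -> v (u i - u j) < e) ->
    exists l : k, forall e : R, 0 < e -> exists N : nat,
       forall i : nat, (N <= i)%N -> v (u i - l) < e.

Definition trivial_norm (R : realType) (A : nzRingType) (a : A) : R :=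
  if a == 0 then 0 else 1.

Definition hybrid_norm (R : realType) (k : fieldType) (v : k -> R) (a : k) : R :=
  Num.max (v a) (trivial_norm R a).

(* A discrete valuation ring is a principal ideal domain with exactly one
   nonzero prime ideal.  The predicate idealr_closed describes the proper
   ideals (1 \notin I); the unit ideal is always principal. *)
Definition principal_ideal (A : comNzRingType) (I : {pred A}) : Prop :=
  exists g : A, forall x, x \in I <-> exists a, x = a * g.

Definition nonzero_prime_ideal (A : comNzRingType) (I : {pred A}) : Prop :=
  [/\ idealr_closed I, prime_idealr_closed I & exists2 x, x \in I & x != 0].

Definition discrete_valuation_ring (A : idomainType) : Prop :=
  (forall I : {pred A}, idealr_closed I -> principal_ideal I) /\
  (exists2 m : {pred A}, nonzero_prime_ideal m &
     forall I : {pred A}, nonzero_prime_ideal I -> I =i m).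

Record analytification (R : realType) (A : comNzRingType) (normA : A -> R)
    (n : nat) : Type := Analytification {
  an_eval :> mpoly n A -> R;
  an_mseminorm : multiplicative_seminorm an_eval;
  an_bounded : forall a : A, an_eval (mpolyC n a) <= normA a }.

HB.instance Definition _ (R : realType) (A : comNzRingType) (normA : A -> R)
  (n : nat) := gen_eqMixin (analytification normA n).
HB.instance Definition _ (R : realType) (A : comNzRingType) (normA : A -> R)
  (n : nat) := gen_choiceMixin (analytification normA n).

HB.instance Definition _ (R : realType) (A : comNzRingType) (normA : A -> R)
  (n : nat) := Topological.copy (analytification normA n)
    (sup_topology (fun f : mpoly n A => Topological.on
      (initial_topology (fun x : analytification normA n => (x f : R))))).

Definition homotopic (R : realType) (X Y : topologicalType) (f g : X -> Y) :
    Prop :=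
  exists H : X * R -> Y,
    [/\ {within [set: X] `*` `[0, 1], continuous H},
        forall x, H (x, 0) = f x & forall x, H (x, 1) = g x].

Definition contractible (R : realType) (X : topologicalType) : Prop :=
  exists x0 : X, homotopic R (@idfun X) (cst x0).

(* Main.v *)
Require Import Defs.
From HB Require Import structures.
From mathcomp Require Import all_boot all_order all_algebra.
From mathcomp Require Import all_classical all_reals topology normedtype.
From mathcomp Require Import sequences realfun exp.
From mathcomp Require Import -(notations) mpoly.
From mathcomp Require Import ring lra.

(** Let B = A[T_1, ..., T_n].  A point x of the analytification is ultrametric,
because it is bounded on the image of the integers ([mseminorm_ultrametric]),
so it extends, for every radius rho >= 0, to the Gauss norm on B[U]
  |sum_i f_i U^i| = max_i |f_i(x)| rho^i,
which is multiplicative ([gaussM]).  The scaling map f(T) |-> f(T U) from B to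
B[U] pulls the Gauss norms of U-discs back to points of the analytification,
and moving the disc moves x:

- the discs of centre 1 and radius t, for t from 0 to 1, lead from f(T * 1),
  that is from x, to the Gauss norm of the unit disc.  By the ultrametric
  inequality the unit disc is also the disc of centre 0 and radius 1
  ([gauss_translate], [deforms_scaling]);
- the discs of centre 0 and radius 1 - t then lead to f(T * 0), that is to the
  value of x at the constant term of f ([deforms_origin]).

This retracts the analytification onto the zero section, whose points are the
bounded seminorms on A, and it remains to contract these
([contractible_from_base]).  Over a field with its hybrid norm, raising a
seminorm to the powers s from 1 to 0 ends at the trivial norm; the boundedness
by max(|.|, 1) survives since s <= 1 ([contractible_hybrid]).  Over a discrete
valuation ring with uniformizer p and order function ord, every bounded
seminorm is y(a) = y(p)^ord(a), and shrinking y(p) to 0 ends at the seminorm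
that is 0 on the maximal ideal and 1 outside it ([contractible_dvr]). *)

Set Implicit Arguments.
Unset Strict Implicit.
Unset Printing Implicit Defensive.

Import Order.TTheory GRing.Theory Num.Theory.
Import numFieldNormedType.Exports.

Local Open Scope classical_set_scope.
Local Open Scope ring_scope.

(** * Multiplicative seminorms and the ultrametric inequality *)

Section Seminorm.
Variables (R : realType) (B : comNzRingType) (x : B -> R).
Hypothesis xP : multiplicative_seminorm x.

Lemma mseminormX f m : x (f ^+ m) = x f ^+ m.
Proof.
elim: m => [|m IH]; first by rewrite !expr0 (mseminorm1 xP).
by rewrite !exprS (mseminormM xP) IH.
Qed.

Lemma mseminorm_sum (I : Type) (r : seq I) (P : pred I) (F : I -> B) :
  x (\sum_(i <- r | P i) F i) <= \sum_(i <- r | P i) x (F i).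
Proof.
elim/big_ind2: _ => [|a b c d ab cd|//]; first by rewrite (mseminorm0 xP).
by apply: le_trans (mseminormD xP _ _) _; apply: lerD.
Qed.

End Seminorm.

Lemma mseminorm_comp (R : realType) (B C : comNzRingType) (x : C -> R)
    (g : {rmorphism B -> C}) :
  multiplicative_seminorm x -> multiplicative_seminorm (x \o g).
Proof.
move=> xP; split => [f||| f h| f h] /=.
- exact: mseminorm_ge0.
- by rewrite rmorph0 (mseminorm0 xP).
- by rewrite rmorph1 (mseminorm1 xP).
- by rewrite rmorphM (mseminormM xP).
- by rewrite rmorphD; exact: (mseminormD xP).
Qed.

(** If q = 1 + d with d > 0, then q^(2m) >= (1 + m d)^2 by Bernoulli, which
exceeds 2m + 1 as soon as m d^2 > 2. *)
Lemma expr_le_linear (R : realType) (q : R) :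
  0 <= q -> (forall m, q ^+ m <= m.+1%:R) -> q <= 1.
Proof.
move=> q0 H; rewrite leNgt; apply/negP => q1.
have [d dE] : {d | q = 1 + d} by exists (q - 1); lra.
have d0 : 0 < d by lra.
have bern m : 1 + m%:R * d <= q ^+ m.
  elim: m => [|m IH]; first by rewrite mul0r addr0 expr0.
  rewrite exprS -natr1.
  have : q * (1 + m%:R * d) <= q * q ^+ m by rewrite ler_wpM2l.
  have : 0 <= m%:R * d * d by rewrite !mulr_ge0 // ltW.
  rewrite dE; nra.
have [m mP] : exists m : nat, 2 / (d * d) < m%:R.
  by exists (Num.bound (2 / (d * d))); apply: archi_boundP;
    rewrite divr_ge0 // mulr_ge0 // ltW.
have dd : 0 < d * d by rewrite mulr_gt0.
have {}mP : 2 < m%:R * (d * d) by rewrite -ltr_pdivrMr.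
have m0 : 0 < m%:R :> R.
  by rewrite -(pmulr_lgt0 _ dd); lra.
(* The exponent 2m lets the square of the linear Bernoulli bound appear. *)
have H2 := H (m * 2)%N; rewrite exprM expr2 in H2.
have sq : (1 + m%:R * d) * (1 + m%:R * d) <= q ^+ m * q ^+ m.
  have ge : 0 <= 1 + m%:R * d by rewrite addr_ge0 // mulr_ge0 // ltW.
  by apply: ler_pM => //; exact: bern.
have h3 : m%:R * 2 < m%:R * (m%:R * (d * d)) by rewrite ltr_pM2l.
have h4 : 0 < m%:R * d by rewrite mulr_gt0.
rewrite -natr1 natrM in H2; nra.
Qed.

Definition ultrametric (R : realType) (B : comNzRingType) (x : B -> R) :=
  forall f g, x (f + g) <= Num.max (x f) (x g).

(** The binomial theorem gives x(f + g)^m <= (m + 1) max(x(f), x(g))^m, and a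
real number whose powers grow at most linearly is at most 1. *)
Lemma mseminorm_ultrametric (R : realType) (B : comNzRingType) (x : B -> R) :
  multiplicative_seminorm x -> (forall m : nat, x m%:R <= 1) -> ultrametric x.
Proof.
move=> xP x1 f g; set M := Num.max _ _.
have fM : x f <= M by rewrite le_max lexx.
have gM : x g <= M by rewrite le_max lexx orbT.
have M0 : 0 <= M by apply: le_trans fM; exact: mseminorm_ge0.
have pow m : x (f + g) ^+ m <= m.+1%:R * M ^+ m.
  rewrite -(mseminormX xP) exprDn.
  apply: le_trans (mseminorm_sum xP _ _ _) _.
  have -> : m.+1%:R * M ^+ m = \sum_(i < m.+1) M ^+ m.
    by rewrite sumr_const card_ord mulr_natl.
  apply: ler_sum => i _.
  rewrite -mulr_natl !(mseminormM xP) !(mseminormX xP).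
  rewrite -[leRHS]mul1r ler_pM ?mulr_ge0 ?exprn_ge0 ?(mseminorm_ge0 xP) //.
  have -> : M ^+ m = M ^+ (m - i) * M ^+ i.
    by rewrite -exprD subnK // -ltnS ltn_ord.
  by rewrite ler_pM ?exprn_ge0 ?(mseminorm_ge0 xP) // lerXn2r ?nnegrE
    ?(mseminorm_ge0 xP).
have [M00|Mn0] := eqVneq M 0.
  by have := pow 1%N; rewrite M00 !expr1 mulr0.
have Mp : 0 < M by rewrite lt_def Mn0.
rewrite -[leRHS]mul1r -ler_pdivrMr //; apply: expr_le_linear.
  by rewrite divr_ge0 // (mseminorm_ge0 xP).
by move=> m; rewrite expr_div_n ler_pdivrMr ?exprn_gt0.
Qed.

Lemma bigmax_ge (R : realType) (I : finType) (F : I -> R) (i : I) :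
  F i <= \big[Num.max/0]_i F i.
Proof. by rewrite (bigD1 i) //= le_max lexx. Qed.

Section Ultrametric.
Variables (R : realType) (B : comNzRingType) (x : B -> R).
Hypothesis xP : multiplicative_seminorm x.
Hypothesis xU : ultrametric x.

Lemma ultrametric_sum (I : Type) (r : seq I) (P : pred I) (F : I -> B) M :
  0 <= M -> (forall i, P i -> x (F i) <= M) -> x (\sum_(i <- r | P i) F i) <= M.
Proof.
move=> M0 FM; elim/big_ind: _ => [|a b aM bM|//];
  first by rewrite (mseminorm0 xP).
by apply: le_trans (xU _ _) _; rewrite ge_max aM bM.
Qed.

Lemma ultrametric_sum_lt (I : Type) (r : seq I) (P : pred I) (F : I -> B) M :
  0 < M -> (forall i, P i -> x (F i) < M) -> x (\sum_(i <- r | P i) F i) < M.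
Proof.
move=> M0 FM; elim/big_ind: _ => [|a b aM bM|//];
  first by rewrite (mseminorm0 xP).
by apply: le_lt_trans (xU _ _) _; rewrite gt_max aM bM.
Qed.

Lemma mseminormN f : x (- f) = x f.
Proof.
have : x (-1) ^+ 2 = 1 by rewrite -(mseminormX xP) sqrrN expr1n (mseminorm1 xP).
move/eqP; rewrite sqrf_eq1 => /orP [/eqP e|/eqP e].
  by rewrite -mulN1r (mseminormM xP) e mul1r.
by have := mseminorm_ge0 xP (-1); rewrite e ler0N1.
Qed.

(** * Gauss norms *)

Definition gauss (rho : R) (F : {poly B}) : R :=
  \big[Num.max/0]_(i < size F) (x F`_i * rho ^+ i).

Variable rho : R.
Hypothesis rho0 : 0 <= rho.
Implicit Types F G : {poly B}.

Lemma gauss_ge0 F : 0 <= gauss rho F.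
Proof.
rewrite /gauss; elim/big_ind: _ => // [a b a0 b0|i _];
  first by rewrite le_max a0.
by rewrite mulr_ge0 ?exprn_ge0 ?(mseminorm_ge0 xP).
Qed.

Lemma gauss_coef F i : x F`_i * rho ^+ i <= gauss rho F.
Proof.
have [iF|iF] := ltnP i (size F).
  exact: (bigmax_ge (fun j : 'I_(size F) => x F`_j * rho ^+ j) (Ordinal iF)).
by rewrite nth_default // (mseminorm0 xP) mul0r gauss_ge0.
Qed.

Lemma gauss_le F M : 0 <= M -> (forall i, x F`_i * rho ^+ i <= M) ->
  gauss rho F <= M.
Proof.
move=> M0 H; rewrite /gauss; elim/big_ind: _ => // a b aM bM.
by rewrite ge_max aM bM.
Qed.

(** Choosing the first index at which the maximum is attained makes all earlier
terms strictly smaller, which isolates one dominant term in a product. *)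
Lemma gauss_attained F : 0 < gauss rho F ->
  exists2 i, x F`_i * rho ^+ i = gauss rho F &
    forall j, (j < i)%N -> x F`_j * rho ^+ j < gauss rho F.
Proof.
move=> F0.
have ex : exists i, gauss rho F <= x F`_i * rho ^+ i.
  apply: contrapT => /forallNP H.
  have : gauss rho F < gauss rho F.
    rewrite {1}/gauss; elim/big_ind: _ => // [a b aM bM|i _].
      by rewrite gt_max aM bM.
    by rewrite ltNge; apply/negP/H.
  by rewrite ltxx.
case: (ex_minnP ex) => i iF imin; exists i.
  by apply/eqP; rewrite eq_le iF gauss_coef.
by move=> j ji; rewrite ltNge; apply/negP => /imin; rewrite leqNgt ji.
Qed.

Lemma gaussD F G : gauss rho (F + G) <= Num.max (gauss rho F) (gauss rho G).
Proof.
apply: gauss_le => [|i]; first by rewrite le_max gauss_ge0.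
rewrite coefD; apply: le_trans (ler_wpM2r (exprn_ge0 i rho0) (xU _ _)) _.
by rewrite maxr_pMl ?exprn_ge0 // ge_max !le_max !gauss_coef orbT.
Qed.

Lemma gaussC b : gauss rho b%:P = x b.
Proof.
apply/eqP; rewrite eq_le; apply/andP; split.
  apply: gauss_le => [|[|i]]; rewrite ?coefC /= ?(mseminorm_ge0 xP) ?mulr1 //.
  by rewrite (mseminorm0 xP) mul0r (mseminorm_ge0 xP).
by have := gauss_coef b%:P 0; rewrite coefC mulr1.
Qed.

Lemma gauss_mul_le F G : gauss rho (F * G) <= gauss rho F * gauss rho G.
Proof.
apply: gauss_le => [|i]; first by rewrite mulr_ge0 ?gauss_ge0.
rewrite coefM.
have [r0|r0] := eqVneq (rho ^+ i) 0.
  by rewrite r0 mulr0 mulr_ge0 ?gauss_ge0.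
have rp : 0 < rho ^+ i by rewrite lt_def r0 exprn_ge0.
rewrite -ler_pdivlMr //; apply: ultrametric_sum => [|j _].
  by rewrite divr_ge0 ?mulr_ge0 ?gauss_ge0 // ltW.
rewrite ler_pdivlMr // (mseminormM xP).
have -> : rho ^+ i = rho ^+ j * rho ^+ (i - j).
  by rewrite -exprD subnKC // -ltnS.
rewrite mulrACA ler_pM ?gauss_coef //;
  by rewrite mulr_ge0 ?exprn_ge0 ?(mseminorm_ge0 xP).
Qed.

(** Gauss's lemma.  If both norms are positive, let i and j be the first indices
at which the norms of F and G are attained.  In the coefficient of F * G of
index i + j, every product F_k G_(i+j-k) with k <> i has k < i or i + j - k < j,
so its term is strictly below the product of the norms, whereas F_i G_j attains
it. *)
Lemma gaussM F G : gauss rho (F * G) = gauss rho F * gauss rho G.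
Proof.
apply/eqP; rewrite eq_le gauss_mul_le /=.
have [F0|F0] := eqVneq (gauss rho F) 0; first by rewrite F0 mul0r gauss_ge0.
have [G0|G0] := eqVneq (gauss rho G) 0; first by rewrite G0 mulr0 gauss_ge0.
have {}F0 : 0 < gauss rho F by rewrite lt_def F0 gauss_ge0.
have {}G0 : 0 < gauss rho G by rewrite lt_def G0 gauss_ge0.
have [i iF iFm] := gauss_attained F0.
have [j jG jGm] := gauss_attained G0.
set M := gauss rho F * gauss rho G.
have Mp : 0 < M by rewrite mulr_gt0.
have eM : M = x (F`_i * G`_j) * rho ^+ (i + j).
  by rewrite (mseminormM xP) exprD mulrACA iF jG.
have rp : 0 < rho ^+ (i + j).
  rewrite lt_def exprn_ge0 // andbT; apply/eqP => r0.
  by move: Mp; rewrite eM r0 mulr0 ltxx.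
have ij : (i < (i + j).+1)%N by rewrite ltnS leq_addr.
have := coefM F G (i + j); rewrite (bigD1 (Ordinal ij)) //= addKn.
set rest := \sum_(_ | _) _ => cE.
(* Each remaining term of the coefficient is strictly dominated. *)
have restM : x rest * rho ^+ (i + j) < M.
  rewrite -ltr_pdivlMr //; apply: ultrametric_sum_lt => [|k ki].
    by rewrite divr_gt0.
  rewrite ltr_pdivlMr // (mseminormM xP).
  have -> : rho ^+ (i + j) = rho ^+ k * rho ^+ (i + j - k).
    by rewrite -exprD subnKC // -ltnS.
  rewrite mulrACA.
  have [kli|] := ltnP k i.
    apply: le_lt_trans (ler_wpM2l _ (gauss_coef G _)) _.
      by rewrite mulr_ge0 ?exprn_ge0 ?(mseminorm_ge0 xP).
    by rewrite ltr_pM2r // iFm.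
  rewrite leq_eqVlt => /orP [eki|ilk].
    by move: ki; rewrite -val_eqE /= eq_sym eki.
  apply: le_lt_trans (ler_wpM2r _ (gauss_coef F _)) _.
    by rewrite mulr_ge0 ?exprn_ge0 ?(mseminorm_ge0 xP).
  have kij : (k <= i + j)%N by rewrite -ltnS.
  by rewrite ltr_pM2l // jGm // ltn_subLR // ltn_add2r.
apply: le_trans (gauss_coef (F * G) (i + j)).
have : M <= Num.max (x (F * G)`_(i + j) * rho ^+ (i + j))
                    (x rest * rho ^+ (i + j)).
  rewrite eM -maxr_pMl ?exprn_ge0 // ler_wpM2r ?exprn_ge0 //.
  have -> : F`_i * G`_j = (F * G)`_(i + j) - rest by rewrite cE addrK.
  by rewrite -(mseminormN rest) xU.
by rewrite le_max => /orP [//|]; rewrite leNgt restM.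
Qed.

Lemma gauss_mseminorm : multiplicative_seminorm (gauss rho).
Proof.
split.
- exact: gauss_ge0.
- by rewrite -polyC0 gaussC (mseminorm0 xP).
- by rewrite -polyC1 gaussC (mseminorm1 xP).
- exact: gaussM.
- move=> F G; apply: le_trans (gaussD F G) _.
  by rewrite ge_max lerDl lerDr !gauss_ge0.
Qed.

End Ultrametric.

(** Translation by c can only decrease the Gauss norm of radius 1, since 'X + c
has norm at most 1; translating back shows that it preserves the norm, that is,
that every point of the unit disc is a centre of it. *)
Lemma gauss_translate (R : realType) (B : comNzRingType) (x : B -> R) c
    (F : {poly B}) :
  multiplicative_seminorm x -> ultrametric x -> x c <= 1 ->
  gauss x 1 (F \Po ('X + c%:P)) <= gauss x 1 F.
Proof.
move=> xP xU xc; have gP := gauss_mseminorm xP xU (@ler01 R).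
have gU : ultrametric (gauss x 1) := gaussD xP xU (@ler01 R).
rewrite comp_polyE; apply: (ultrametric_sum gP gU) => [|i _].
  exact: (mseminorm_ge0 gP).
rewrite -mul_polyC (mseminormM gP) (mseminormX gP) gaussC //.
apply: le_trans _ (gauss_coef xP (@ler01 R) F i).
rewrite expr1n ler_wpM2l ?(mseminorm_ge0 xP) //.
rewrite exprn_ile1 ?(mseminorm_ge0 gP) //.
apply: le_trans (gU _ _) _; rewrite ge_max gaussC // xc andbT.
apply: gauss_le => // i'; rewrite coefX expr1n mulr1.
by case: eqP => _; rewrite ?(mseminorm0 xP) ?(mseminorm1 xP).
Qed.

(** * Topology of the analytification and its deformations *)

Lemma continuous_pair (Z U V : topologicalType) (f : Z -> U) (g : Z -> V) :
  continuous f -> continuous g -> continuous (fun z => (f z, g z)).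
Proof. by move=> cf cg z; exact: (cvg_pair (cf z) (cg z)). Qed.

Lemma continuous_bigmax (R : realType) (Z : topologicalType) (I : Type)
    (r : seq I) (F : I -> Z -> R) :
  (forall i, continuous (F i)) ->
  continuous (fun z => \big[Num.max/0]_(i <- r) F i z).
Proof.
move=> cF; elim: r => [|i r IH].
  by under eq_fun do rewrite big_nil; move=> z; exact: cvg_cst.
under eq_fun do rewrite big_cons.
by move=> z; apply: continuous_max; [exact: cF|exact: IH].
Qed.

Section Topology.
Variables (R : realType) (A : comNzRingType) (normA : A -> R) (n : nat).
Local Notation X := (analytification normA n).

Lemma an_ext (x y : X) : (forall f, x f = y f) -> x = y.
Proof.
case: x y => [x xP xA] [y yP yA] /= /funext e; move: xP xA yP yA; rewrite e.
by move=> xP xA yP yA; congr Analytification; exact: Prop_irrelevance.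
Qed.

Lemma an_eval_continuous f : continuous (fun x : X => x f).
Proof.
move=> x; have /cvg_sup/(_ f) xx : (nbhs x --> x) by exact: cvg_id.
apply: cvg_trans (@initial_continuous _ _ (fun x : X => (x f : R)) x).
exact: cvg_app xx.
Qed.

Lemma an_continuous (Z : topologicalType) (H : Z -> X) :
  (forall f, continuous (fun z => H z f)) -> continuous H.
Proof.
move=> Hf z; apply/cvg_sup => f U /=.
rewrite (@nbhsE (initial_topology (fun x : X => (x f : R)))).
move=> -[V [[W oW <-] Wz] WU].
apply: filterS WU _; apply: (Hf f z).
exact: open_nbhs_nbhs.
Qed.

(** Continuity is required at all real times rather than on [0, 1] only: the
homotopies below extend to the whole line, and the subspace topology then plays
a role only in [deforms_contractible]. *)
Definition deforms (g h : X -> X) :=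
  exists H : X * R -> X,
    [/\ continuous H, forall x, H (x, 0) = g x & forall x, H (x, 1) = h x].

(** Continuity may be tested on one f at a time, where the values are real: the
glued homotopy is then the first one stopped at its end, plus the second one
held at its start, minus the common value g2 -- a continuous expression without
case distinction. *)
Lemma deforms_trans (g1 g2 g3 : X -> X) :
  deforms g1 g2 -> deforms g2 g3 -> deforms g1 g3.
Proof.
move=> [H [cH H0 H1]] [K [cK K0 K1]].
(* H runs over the times up to 1/2 and K over the times from 1/2 on. *)
pose p (z : X * R) := (z.1, Num.min (2 * z.2) 1).
pose q (z : X * R) := (z.1, Num.max (2 * z.2 - 1) 0).
have c2 : continuous (fun z : X * R => 2 * z.2).
  by move=> z; apply: cvgM; [exact: cvg_cst|exact: cvg_snd].
have c1 : continuous (fun z : X * R => z.1) by move=> z; exact: cvg_fst.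
have cp : continuous p.
  apply: (continuous_pair c1) => z.
  by apply: (@continuous_min _ _ (fun z : X * R => 2 * z.2) (cst 1));
    [exact: c2|exact: cvg_cst].
have cq : continuous q.
  apply: (continuous_pair c1) => z.
  apply: (@continuous_max _ _ (fun z : X * R => 2 * z.2 - 1) (cst 0));
    last exact: cvg_cst.
  by apply: cvgB; [exact: c2|exact: cvg_cst].
have pE z : z.2 <= 2^-1 -> q z = (z.1, 0).
  by move=> z2; rewrite /q; congr pair; apply/max_idPr; lra.
have qE z : 2^-1 <= z.2 -> p z = (z.1, 1).
  by move=> z2; rewrite /p; congr pair; apply/min_idPr; lra.
exists (fun z => if z.2 <= 2^-1 then H (p z) else K (q z)); split.
- apply: an_continuous => f.
  rewrite [X in continuous X](_ : _ =
    fun z => H (p z) f + K (q z) f - g2 z.1 f).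
    have ce (L : X * R -> X) : continuous L -> continuous (fun z => L z f).
      move=> cL z.
      exact: continuous_comp (cL z) (@an_eval_continuous f (L z)).
    have cg2 : continuous (fun z : X * R => g2 z.1 f).
      under eq_fun do rewrite -K0.
      have c10 : continuous (fun z : X * R => (z.1, 0 : R)).
        by apply: (continuous_pair c1) => z; exact: cvg_cst.
      by apply: (ce (fun z => K (z.1, 0))) => z;
        apply: continuous_comp (c10 z) (cK _).
    move=> z; apply: cvgB; last exact: cg2.
    apply: cvgD.
      by apply: (ce (H \o p)) => {}z; apply: continuous_comp (cp z) (cH _).
    by apply: (ce (K \o q)) => {}z; apply: continuous_comp (cq z) (cK _).
  apply/funext => z; case: ifPn => [z2|].
    by rewrite (pE _ z2) K0 addrK.
  by rewrite -ltNge => z2; rewrite (qE _ (ltW z2)) H1 addrC addKr.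
- move=> x; rewrite /= invr_ge0 ler0n -H0; congr (H (_, _)).
  by rewrite /= mulr0 min_l.
- move=> x; rewrite /= ifF; last by apply/negbTE; rewrite -ltNge; lra.
  by rewrite -K1 /q /=; congr (K (_, _)); rewrite max_l; lra.
Qed.

Lemma deforms_contractible (x0 : X) :
  deforms idfun (cst x0) -> contractible R X.
Proof.
move=> [H [cH H0 H1]]; exists x0; exists H; split => //.
exact: continuous_subspaceT.
Qed.

End Topology.

(** * Scaling the coordinates *)

Section Scaling.
Variables (A : comNzRingType) (n : nat).
Local Notation Xvar i := (@mpolyX n A (mnm1 i)).

Lemma mpoly_rmorph_ext (S : comNzRingType) (g h : {rmorphism mpoly n A -> S}) :
  (forall a, g (mpolyC n a) = h (mpolyC n a)) ->
  (forall i, g (Xvar i) = h (Xvar i)) ->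
  g =1 h.
Proof.
move=> ghC ghX f; rewrite [f]mpolyE !rmorph_sum /=; apply: eq_bigr => m _.
rewrite -mul_mpolyC !rmorphM ghC mpolyXE_id !rmorph_prod; congr (_ * _).
by apply: eq_bigr => i _; rewrite !rmorphXn ghX.
Qed.

(** This is f(T) |-> f(T U), with 'X in the role of U. *)
Definition scaling : mpoly n A -> {poly mpoly n A} :=
  mmap (polyC \o @mpolyC n A) (fun i => (Xvar i)%:P * 'X).

HB.instance Definition _ := GRing.RMorphism.on scaling.

Lemma scalingC a : scaling (mpolyC n a) = (mpolyC n a)%:P.
Proof. exact: mmapC. Qed.

Lemma scalingX i : scaling (Xvar i) = (Xvar i)%:P * 'X.
Proof. by rewrite /scaling mmapX mmap1U. Qed.

Lemma scaling_at1 f : (scaling f).[1] = f.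
Proof.
apply: (@mpoly_rmorph_ext _ (horner_eval 1 \o scaling) idfun) => [a|i] /=.
  by rewrite /horner_eval scalingC hornerC.
by rewrite /horner_eval scalingX hornerM hornerC hornerX mulr1.
Qed.

Lemma scaling_at0 f : (scaling f).[0] = mpolyC n (mcoeff (@mnm0 n) f).
Proof.
apply: (@mpoly_rmorph_ext _ (horner_eval 0 \o scaling)
  (@mpolyC n A \o mcoeff (@mnm0 n))) => [a|i] /=.
  by rewrite /horner_eval scalingC hornerC mpolyCK.
rewrite /horner_eval scalingX hornerM hornerC hornerX mulr0 mcoeffX.
by rewrite -mdeg_eq0 mdeg1 /= mpolyC0.
Qed.

End Scaling.

(** * Retraction onto the zero section *)

Section Deformation.
Variables (R : realType) (A : comNzRingType) (normA : A -> R) (n : nat).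
Hypothesis normA_nat : forall m : nat, normA m%:R <= 1.
Local Notation X := (analytification normA n).

Lemma an_ultrametric (x : X) : ultrametric x.
Proof.
apply: mseminorm_ultrametric (an_mseminorm x) _ => m.
by rewrite -(rmorph_nat (@mpolyC n A));
  apply: le_trans (an_bounded x _) (normA_nat m).
Qed.

Section GaussPath.
Variable g : {rmorphism mpoly n A -> {poly mpoly n A}}.
Hypothesis gC : forall a, g (mpolyC n a) = (mpolyC n a)%:P.

(** Two morphisms g are used, sending f(T) to f(T U) and to f(T (1 + U)): they
give the discs of centres 0 and 1. *)
Lemma gauss_path_mseminorm (x : X) (t : R) :
  multiplicative_seminorm (gauss x `|t| \o g).
Proof.
apply: mseminorm_comp; apply: gauss_mseminorm => //; first exact: an_mseminorm.
exact: an_ultrametric.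
Qed.

Lemma gauss_path_bounded (x : X) (t : R) a :
  (gauss x `|t| \o g) (mpolyC n a) <= normA a.
Proof.
by rewrite /= gC gaussC ?an_bounded //; exact: an_mseminorm.
Qed.

(** The absolute value makes the radius nonnegative at all times. *)
Definition gauss_path (z : X * R) : X :=
  Analytification (gauss_path_mseminorm z.1 z.2) (gauss_path_bounded z.1 z.2).

Lemma gauss_path_continuous : continuous gauss_path.
Proof.
apply: an_continuous => f /=; rewrite /gauss.
apply: continuous_bigmax => i z; apply: cvgM.
  exact: (@continuous_comp _ _ _ fst (fun x : X => x (g f)`_i) z cvg_fst
    (@an_eval_continuous _ _ _ _ _ _)).
apply: (@continuous_comp _ _ _ (fun z : X * R => `|z.2|) (fun y => y ^+ i)).
  by apply: cvg_norm; exact: cvg_snd.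
exact: exprn_continuous.
Qed.

Lemma gauss_path0 (x : X) f : gauss_path (x, 0) f = x (g f).[0].
Proof.
have xP := an_mseminorm x.
rewrite /= normr0 horner_coef0; apply/eqP; rewrite eq_le; apply/andP; split.
  apply: gauss_le => [|[|i]]; rewrite ?mulr1 ?(mseminorm_ge0 xP) //.
  by rewrite expr0n mulr0 (mseminorm_ge0 xP).
by rewrite -[leLHS]mulr1; exact: (gauss_coef xP (lexx 0) (g f) 0).
Qed.

End GaussPath.

Lemma origin_mseminorm (x : X) :
  multiplicative_seminorm (x \o (@mpolyC n A \o mcoeff (@mnm0 n))).
Proof. exact: mseminorm_comp (an_mseminorm x). Qed.

Lemma origin_bounded (x : X) a :
  (x \o (@mpolyC n A \o mcoeff (@mnm0 n))) (mpolyC n a) <= normA a.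
Proof. by rewrite /= mpolyCK an_bounded. Qed.

(** The retraction onto the zero section. *)
Definition origin (x : X) : X :=
  Analytification (origin_mseminorm x) (origin_bounded x).

(** The parameter 'X + 1 in place of 'X makes 1 the centre of the discs, so that
radius 0 gives back x.  At radius 1 the centre is moved back to 0. *)
Lemma deforms_scaling :
  deforms idfun (fun x : X => gauss_path (@scalingC A n) (x, 1)).
Proof.
pose g := comp_poly ('X + 1%:P) \o @scaling A n.
have gC a : g (mpolyC n a) = (mpolyC n a)%:P.
  by rewrite /g /= scalingC comp_polyC.
exists (gauss_path gC); split; first exact: gauss_path_continuous.
  move=> x; apply: an_ext => f.
  by rewrite gauss_path0 /g /= horner_comp hornerD hornerX hornerC add0r
    scaling_at1.
move=> x; apply: an_ext => f; rewrite /= normr1; have xP := an_mseminorm x.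
have xU := an_ultrametric x.
apply/eqP; rewrite eq_le gauss_translate ?(mseminorm1 xP) //=.
rewrite -{1}[scaling f](comp_polyXaddC_K _ 1) -polyCN.
by rewrite gauss_translate // mseminormN // (mseminorm1 xP).
Qed.

Lemma deforms_origin :
  deforms (fun x : X => gauss_path (@scalingC A n) (x, 1)) origin.
Proof.
exists (fun z => gauss_path (@scalingC A n) (z.1, 1 - z.2)); split => [|x|x].
- move=> z; apply: (@continuous_comp _ _ _ (fun z : X * R => (z.1, 1 - z.2)));
    last exact: gauss_path_continuous.
  move: z; apply: continuous_pair => z; first exact: cvg_fst.
  by apply: cvgB; [exact: cvg_cst|exact: cvg_snd].
- by rewrite subr0.
- by apply: an_ext => f; rewrite subrr gauss_path0 scaling_at0.
Qed.

(** A contraction S of the base may depend on the whole point x; it is composed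
with evaluation of polynomials at T = 0.  The end point of the contraction is
the seminorm s1, so it has to be a point of the base also when no x is given. *)
Theorem contractible_from_base (S : X -> R -> A -> R) (s1 : A -> R) :
  (forall x t, multiplicative_seminorm (S x t)) ->
  (forall x t a, S x t a <= normA a) ->
  (forall a, continuous (fun z : X * R => S z.1 z.2 a)) ->
  (forall x a, S x 0 a = x (mpolyC n a)) ->
  multiplicative_seminorm s1 -> (forall a, s1 a <= normA a) ->
  (forall x a, S x 1 a = s1 a) ->
  contractible R X.
Proof.
move=> SP SA cS S0 s1P s1A S1.
pose c0 : {rmorphism mpoly n A -> A} := mcoeff (@mnm0 n).
have lift_mseminorm (s : A -> R) : multiplicative_seminorm s ->
    multiplicative_seminorm (s \o c0).
  exact: mseminorm_comp.
have lift_bounded (s : A -> R) : (forall a, s a <= normA a) ->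
    forall a, (s \o c0) (mpolyC n a) <= normA a.
  by move=> sA a; rewrite /= /c0 mpolyCK.
pose lift s sP sA : X :=
  Analytification (lift_mseminorm s sP) (lift_bounded s sA).
apply: (@deforms_contractible _ _ _ _ (lift s1 s1P s1A)).
apply: deforms_trans deforms_scaling _; apply: deforms_trans deforms_origin _.
exists (fun z => lift _ (SP z.1 z.2) (SA z.1 z.2)); split => [|x|x].
- by apply: an_continuous => f; exact: cS.
- by apply: an_ext => f /=; rewrite S0.
- by apply: an_ext => f /=; rewrite S1.
Qed.

End Deformation.

(** * Bounded seminorms on the base *)

Section Fade.
Variable R : realType.

(** A path from 1 to 0 over the times 0 to 1 whose values stay in [0, 1] at all
times, as needed for an exponent or a factor that preserves the bounds. *)
Definition fade (t : R) : R := Num.min 1 `|1 - t|.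

Lemma fade_ge0 t : 0 <= fade t.
Proof. by rewrite le_min ler01 normr_ge0. Qed.

Lemma fade_le1 t : fade t <= 1.
Proof. by rewrite ge_min lexx. Qed.

Lemma fade0 : fade 0 = 1.
Proof. by rewrite /fade subr0 normr1 minxx. Qed.

Lemma fade1 : fade 1 = 0.
Proof. by rewrite /fade subrr normr0 min_r. Qed.

Lemma continuous_fade (Z : topologicalType) :
  continuous (fun z : Z * R => fade z.2).
Proof.
move=> z; apply: (@continuous_min _ _ (cst 1) (fun z : Z * R => `|1 - z.2|)).
  exact: cvg_cst.
by apply: cvg_norm; apply: cvgB; [exact: cvg_cst|exact: cvg_snd].
Qed.

End Fade.

Section HybridField.
Variables (R : realType) (k : fieldType).

(** The value at 0 is set apart because powR 0 0 is 1, whereas the seminorm with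
exponent 0 is the trivial norm. *)
Definition powR_seminorm (y : k -> R) (s : R) (a : k) : R :=
  if a == 0 then 0 else powR (y a) s.

Lemma mseminorm_gt0 (y : k -> R) a : multiplicative_seminorm y -> a != 0 ->
  0 < y a.
Proof.
move=> yP a0; rewrite lt_def (mseminorm_ge0 yP) andbT; apply/eqP => ya.
have := mseminorm1 yP; rewrite -(divff a0) (mseminormM yP) ya mul0r.
by move/eqP; rewrite eq_sym oner_eq0.
Qed.

Lemma powR_seminormP (y : k -> R) s : 0 <= s ->
  multiplicative_seminorm y -> ultrametric y ->
  multiplicative_seminorm (powR_seminorm y s).
Proof.
move=> s0 yP yU; have ge0 a : 0 <= powR_seminorm y s a.
  by rewrite /powR_seminorm; case: ifP => // _; exact: powR_ge0.
split => // [|| a b | a b]; rewrite /powR_seminorm.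
- by rewrite eqxx.
- by rewrite oner_eq0 (mseminorm1 yP) powR1.
- rewrite mulf_eq0; case: eqP => [_|_]; first by rewrite mul0r.
  case: eqP => [_|_]; first by rewrite mulr0.
  by rewrite (mseminormM yP) powRM // (mseminorm_ge0 yP).
- have [ab|ab] := eqVneq (a + b) 0; first by rewrite addr_ge0 //; exact: ge0.
  have [a0|a0] := eqVneq a 0;
    first by move: ab; rewrite a0 !add0r => /negbTE ->.
  have [b0|b0] := eqVneq b 0; first by rewrite b0 !addr0.
  apply: le_trans (_ : powR (Num.max (y a) (y b)) s <= _).
    by apply: ge0_ler_powR => //; rewrite ?nnegrE ?le_max ?(mseminorm_ge0 yP).
  by case: (leP (y a)) => _; rewrite ?lerDl ?lerDr powR_ge0.
Qed.

Lemma trivial_norm_field_mseminorm :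
  multiplicative_seminorm (@trivial_norm R k).
Proof.
rewrite /trivial_norm; split => [a||| a b | a b].
- by case: ifP.
- by rewrite eqxx.
- by rewrite oner_eq0.
- by rewrite mulf_eq0; case: eqP => _; case: eqP => _;
    rewrite ?mul0r ?mulr0 ?mulr1.
- have [->|a0] := eqVneq a 0; first by rewrite !add0r.
  have [->|b0] := eqVneq b 0; first by rewrite !addr0 (negbTE a0).
  by case: eqP => _; lra.
Qed.

Theorem contractible_hybrid (v : k -> R) (n : nat) :
  absolute_value v -> non_archimedean v ->
  contractible R (analytification (hybrid_norm v) n).
Proof.
move=> [vP _] vU.
have nat1 (m : nat) : hybrid_norm v m%:R <= 1.
  rewrite /hybrid_norm ge_max /trivial_norm; apply/andP; split;
    last by case: ifP.
  elim: m => [|m IH]; first by rewrite (mseminorm0 vP).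
  by rewrite -natr1; apply: le_trans (vU _ _) _;
    rewrite ge_max IH (mseminorm1 vP) lexx.
pose base (x : analytification (hybrid_norm v) n) := x \o @mpolyC n k.
have baseP x : multiplicative_seminorm (base x).
  exact: mseminorm_comp (an_mseminorm x).
have baseU x : ultrametric (base x).
  move=> a b; rewrite /base /= mpolyCD; exact: an_ultrametric.
have norm1 (a : k) : a != 0 -> 1 <= hybrid_norm v a.
  by move=> a0; rewrite /hybrid_norm /trivial_norm (negbTE a0) le_max lexx orbT.
apply: (contractible_from_base nat1
  (S := fun x t => powR_seminorm (base x) (fade t)) (s1 := @trivial_norm R k)).
- by move=> x t; apply: powR_seminormP; rewrite ?fade_ge0.
- move=> x t a; rewrite /powR_seminorm; case: eqVneq => [_|a0].
    by rewrite /hybrid_norm le_max (mseminorm_ge0 vP).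
  have [y1|y1] := leP (base x a) 1.
    have p1 : powR 1 (fade t) = 1 by rewrite powR1.
    apply: le_trans (norm1 _ a0); rewrite -[leRHS]p1.
    by apply: ge0_ler_powR;
      rewrite ?nnegrE ?fade_ge0 ?(mseminorm_ge0 (baseP x)).
  by apply: le_trans (ler1_powR (ltW y1) (fade_le1 t)) (an_bounded x a).
- move=> a; rewrite /powR_seminorm; case: eqVneq => [_|a0].
    by move=> z; exact: cvg_cst.
  have y0 x : 0 < base x a by exact: mseminorm_gt0.
  under eq_fun do rewrite /powR gt_eqF //.
  have cbase : continuous (fun z : analytification (hybrid_norm v) n * R =>
    base z.1 a).
    move=> z; exact: (@continuous_comp _ _ _ fst (fun x => base x a) z cvg_fst
      (@an_eval_continuous _ _ _ _ _ _)).
  move=> z; have cln := continuous_comp (cbase z) (continuous_ln (y0 _)).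
  have cM : {for z, continuous (fun z => fade z.2 * ln (base z.1 a))}.
    by apply: cvgM; [exact: continuous_fade|exact: cln].
  exact: (continuous_comp cM (@continuous_expR R _)).
- move=> x a; rewrite /powR_seminorm fade0.
  case: eqVneq => [->|_];
    first by rewrite mpolyC0 (mseminorm0 (an_mseminorm x)).
  by rewrite powRr1 // (mseminorm_ge0 (baseP x)).
- exact: trivial_norm_field_mseminorm.
- by move=> a; rewrite le_max lexx orbT.
- move=> x a; rewrite /powR_seminorm /trivial_norm fade1.
  by rewrite powRr0.
Qed.

End HybridField.

Definition divides (A : idomainType) (p a : A) := exists c, a = c * p.

Section Order.
Variables (A : idomainType) (p : A).
Hypotheses (p0 : p != 0) (pN1 : ~ divides p 1).
Hypothesis p_prime : forall a b, divides p (a * b) ->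
  divides p a \/ divides p b.
Hypothesis p_order : forall a, a != 0 ->
  exists m b, a = p ^+ m * b /\ ~ divides p b.

Lemma adic_order_subproof a :
  {m | a != 0 -> exists2 b, a = p ^+ m * b & ~ divides p b}.
Proof.
have [->|a0] := eqVneq a 0; first by exists 0%N.
by apply: cid; have [m [b [ab pb]]] := p_order a0; exists m => _; exists b.
Qed.

(** The value at 0 is arbitrary. *)
Definition adic_order a : nat := projT1 (adic_order_subproof a).

Lemma adic_orderP a : a != 0 ->
  exists2 b, a = p ^+ adic_order a * b & ~ divides p b.
Proof. by rewrite /adic_order; case: adic_order_subproof. Qed.

Lemma divides0 : divides p 0. Proof. by exists 0; rewrite mul0r. Qed.

Lemma adic_order_ge m b : p ^+ m * b != 0 -> (m <= adic_order (p ^+ m * b)%R)%N.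
Proof.
move=> a0; have [b' e nb'] := adic_orderP a0; rewrite leqNgt; apply/negP => lt.
apply: nb'; exists (p ^+ (m - (adic_order (p ^+ m * b)).+1) * b).
apply: (mulfI (expf_neq0 (adic_order (p ^+ m * b)) p0)).
by rewrite -e -[in LHS](subnKC lt) exprD exprS; set q := p ^+ (m - _); ring.
Qed.

Lemma adic_order_eq m b : ~ divides p b -> adic_order (p ^+ m * b) = m.
Proof.
move=> nb; have b0 : b != 0 by apply: contra_notN nb => /eqP ->;
  exact: divides0.
have a0 : p ^+ m * b != 0 by rewrite mulf_neq0 ?expf_neq0.
apply/eqP; rewrite eqn_leq adic_order_ge // andbT leqNgt; apply/negP => lt.
have [b' e _] := adic_orderP a0; apply: nb.
exists (p ^+ (adic_order (p ^+ m * b) - m.+1) * b').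
apply: (mulfI (expf_neq0 m p0)).
by rewrite {1}e -[in LHS](subnKC lt) exprD exprS; set q := p ^+ (_ - _); ring.
Qed.

Lemma adic_orderM a b : a != 0 -> b != 0 ->
  adic_order (a * b) = (adic_order a + adic_order b)%N.
Proof.
move=> /adic_orderP [a' ea na] /adic_orderP [b' eb nb].
rewrite {1}ea {1}eb mulrACA -exprD adic_order_eq // => /p_prime [].
  exact: na.
exact: nb.
Qed.

Lemma adic_order1 : adic_order 1 = 0%N.
Proof. by rewrite -[1](mulr1 (p ^+ 0)) adic_order_eq. Qed.

Lemma adic_orderD a b : a != 0 -> b != 0 -> a + b != 0 ->
  (minn (adic_order a) (adic_order b) <= adic_order (a + b)%R)%N.
Proof.
move=> /adic_orderP [a' ea _] /adic_orderP [b' eb _]; set m := minn _ _ => ab0.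
have ema : (m <= adic_order a)%N by exact: geq_minl.
have emb : (m <= adic_order b)%N by exact: geq_minr.
have e : a + b =
    p ^+ m * (p ^+ (adic_order a - m) * a' + p ^+ (adic_order b - m) * b').
  by rewrite mulrDr !mulrA -!exprD !subnKC // -ea -eb.
by rewrite e adic_order_ge // -e.
Qed.

Section OrderSeminorm.
Variables (R : realType) (c : R).
Hypotheses (c0 : 0 <= c) (c1 : c <= 1).

Definition order_seminorm (a : A) : R :=
  if a == 0 then 0 else c ^+ adic_order a.

Lemma order_seminorm_ge0 a : 0 <= order_seminorm a.
Proof. by rewrite /order_seminorm; case: ifP => // _; rewrite exprn_ge0. Qed.

Lemma order_seminormP : multiplicative_seminorm order_seminorm.
Proof.
split; first exact: order_seminorm_ge0.
- by rewrite /order_seminorm eqxx.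
- by rewrite /order_seminorm oner_eq0 adic_order1.
- move=> a b; rewrite /order_seminorm mulf_eq0.
  case: eqVneq => [_|a0]; first by rewrite mul0r.
  case: eqVneq => [_|b0]; first by rewrite mulr0.
  by rewrite adic_orderM // exprD.
- move=> a b; have [->|a0] := eqVneq a 0;
    first by rewrite add0r lerDr order_seminorm_ge0.
  have [->|b0] := eqVneq b 0; first by rewrite addr0 lerDl order_seminorm_ge0.
  have [->|ab0] := eqVneq (a + b) 0.
    by rewrite {1}/order_seminorm eqxx addr_ge0 ?order_seminorm_ge0.
  rewrite /order_seminorm (negbTE a0) (negbTE b0) (negbTE ab0).
  apply: le_trans (_ : c ^+ minn (adic_order a) (adic_order b) <= _).
    by apply: ler_wiXn2l => //; exact: adic_orderD.
  by rewrite /minn; case: ifP => _; rewrite ?lerDl ?lerDr exprn_ge0.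
Qed.

Lemma order_seminorm_bounded a : order_seminorm a <= trivial_norm R a.
Proof.
by rewrite /order_seminorm /trivial_norm; case: ifP => // _; rewrite exprn_ile1.
Qed.

End OrderSeminorm.
End Order.

(** A generator p of the nonzero prime ideal m is a uniformizer.  If the
intersection of the ideals (p^j) had a generator h <> 0, then h = d p with d
again in the intersection, so h would divide d and p would be a unit; hence
every a <> 0 has a finite order.  For a bounded ultrametric seminorm y, the
elements with y(b) < 1 form a prime ideal, which is either 0 or m; so y(b) = 1
for each b that p does not divide. *)
Lemma dvr_uniformizer (A : idomainType) : discrete_valuation_ring A ->
  exists p : A, [/\ p != 0, ~ divides p 1,
    forall a b, divides p (a * b) -> divides p a \/ divides p b,
    forall a, a != 0 -> exists m b, a = p ^+ m * b /\ ~ divides p b &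
    forall (R : realType) (y : A -> R), multiplicative_seminorm y ->
      (forall a, y a <= trivial_norm R a) -> ultrametric y ->
      forall b, ~ divides p b -> y b = 1].
Proof.
move=> [pid [m [mI mP [g gm g0]] mU]].
have [p mp] := pid _ mI; have [_ m1 _] := mI.
have pN1 : ~ divides p 1 by move/mp; apply/negP.
have p0 : p != 0.
  by apply: contraNneq g0 => p0; have [c ->] := (mp g).1 gm; rewrite p0 mulr0.
exists p; split => //.
- by move=> a b /mp /mP /orP [/mp|/mp]; [left|right].
- move=> a a0.
  pose I : {pred A} := fun b => `[< forall j, divides (p ^+ j) b >].
  have II : idealr_closed I.
    split.
    + by apply/asboolP => j; exists 0; rewrite mul0r.
    + by apply/negP => /asboolP /(_ 1%N); rewrite expr1.
    + move=> c u w /asboolP Iu /asboolP Iw; apply/asboolP => j.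
      have [d ->] := Iu j; have [e ->] := Iw j.
      by exists (c * d + e); rewrite mulrDl mulrA.
  have [h hI] := pid _ II.
  have h0 : h = 0.
    have /asboolP Ih : h \in I by apply/hI; exists 1; rewrite mul1r.
    have [d hd] := Ih 1%N; rewrite expr1 in hd.
    have : d \in I.
      apply/asboolP => j; have [e he] := Ih j.+1; exists e.
      by apply: (mulIf p0); rewrite -hd he exprSr mulrA.
    move=> /hI [e de]; apply/eqP/negPn/negP => hn0.
    apply: pN1; exists e; apply: (mulfI hn0).
    by rewrite mulr1 {1}hd de; ring.
  have aI : ~ (forall j, divides (p ^+ j) a).
    move=> aj; have /hI [c] : a \in I by apply/asboolP.
    by rewrite h0 mulr0; exact/eqP.
  have ex : exists j, ~~ `[< divides (p ^+ j) a >].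
    by move/existsNP: aI => [j aj]; exists j; apply/asboolP.
  case: (ex_minnP ex) => -[|j] /asboolP nj jmin.
    by case: nj; exists a; rewrite mulr1.
  have /asboolP [b ab] : `[< divides (p ^+ j) a >].
    by apply/negPn/negP => /jmin; rewrite ltnn.
  exists j, b; split; first by rewrite mulrC.
  by move=> [c bc]; apply: nj; exists c; rewrite ab bc exprS mulrA.
- move=> R y yP y1 yU b nb.
  have y1' a : y a <= 1.
    by apply: le_trans (y1 a) _; rewrite /trivial_norm; case: ifP.
  apply/eqP; rewrite eq_le y1' leNgt; apply/negP => yb.
  have b0 : b != 0 by apply: contra_notN nb => /eqP ->; exact: divides0.
  pose I : {pred A} := fun a => y a < 1.
  suff /mU /(_ b) bI : nonzero_prime_ideal I by apply/nb/mp; rewrite -bI.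
  split; last by exists b.
  + split; first by rewrite unfold_in /= (mseminorm0 yP).
      by rewrite unfold_in /= (mseminorm1 yP) ltxx.
    move=> a u w; rewrite !unfold_in /= => yu yw.
    apply: le_lt_trans (yU _ _) _; rewrite gt_max yw andbT (mseminormM yP).
    by apply: le_lt_trans yu; rewrite ler_piMl ?(mseminorm_ge0 yP).
  + move=> u w; rewrite !unfold_in /= (mseminormM yP) => yuw.
    have [yu|yu] := ltP (y u) 1; first by [].
    rewrite /=; apply: le_lt_trans yuw; rewrite ler_peMl //;
      exact: (mseminorm_ge0 yP).
Qed.

Theorem contractible_dvr (R : realType) (A : idomainType) (n : nat) :
  discrete_valuation_ring A ->
  contractible R (analytification (@trivial_norm R A) n).
Proof.
move=> /dvr_uniformizer [p [p0 pN1 p_prime p_order p_unit]].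
have triv1 (a : A) : trivial_norm R a <= 1 by rewrite /trivial_norm; case: ifP.
pose base (x : analytification (@trivial_norm R A) n) := x \o @mpolyC n A.
have baseP x : multiplicative_seminorm (base x).
  exact: mseminorm_comp (an_mseminorm x).
have baseU x : ultrametric (base x).
  by move=> a b; rewrite /base /= mpolyCD; exact: an_ultrametric.
have bp0 x : 0 <= base x p by exact: mseminorm_ge0.
have bp1 x : base x p <= 1 by exact: le_trans (an_bounded x p) _.
apply: (contractible_from_base (fun m => triv1 m%:R)
  (S := fun x t => order_seminorm p_order (base x p * fade t))
  (s1 := order_seminorm p_order 0)).
- by move=> x t; apply: order_seminormP => //;
    rewrite ?mulr_ge0 ?mulr_ile1 ?fade_ge0 ?fade_le1.
- by move=> x t a; apply: order_seminorm_bounded;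
    rewrite ?mulr_ge0 ?mulr_ile1 ?fade_ge0 ?fade_le1.
- move=> a; rewrite /order_seminorm; case: eqVneq => [_|a0].
    by move=> z; exact: cvg_cst.
  move=> z; apply: (@continuous_comp _ _ _ (fun z => base z.1 p * fade z.2)
    (fun y => y ^+ adic_order p_order a)); last exact: exprn_continuous.
  apply: cvgM.
    exact: (@continuous_comp _ _ _ fst (fun x => base x p) z cvg_fst
      (@an_eval_continuous _ _ _ _ _ _)).
  exact: continuous_fade.
- move=> x a; rewrite fade0 mulr1 /order_seminorm.
  case: eqVneq => [->|a0];
    first by rewrite mpolyC0 (mseminorm0 (an_mseminorm x)).
  have [b ab nb] := adic_orderP p_order a0.
  rewrite -[RHS]/(base x a) {2}ab (mseminormM (baseP x)) (mseminormX (baseP x)).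
  by rewrite (p_unit _ _ (baseP x) (an_bounded x) (baseU x) _ nb) mulr1.
- exact: order_seminormP.
- by move=> a; exact: order_seminorm_bounded.
- by move=> x a; rewrite fade1 mulr0.
Qed.

Theorem mainTheorem5 (R : realType) (n : nat) (hn : (1 <= n)%N) :
  (forall (k : fieldType) (v : k -> R),
     absolute_value v -> non_archimedean v -> nontrivial v -> complete_for v ->
     contractible R (analytification (hybrid_norm v) n)) /\
  (forall A : idomainType, discrete_valuation_ring A ->
     contractible R (analytification (@trivial_norm R A) n)).
Proof.
split=> [k v v_abs v_ultra _ _ | A A_dvr].
  exact: contractible_hybrid.
exact: contractible_dvr.
Qed.
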